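(* Let $\mathcal{A}$ be a finite set and let $f:\mathcal{A}\times[0,1]\to\mathbb{R}$ be such that $f(a,\cdot)$ is continuous for each $a\in\mathcal{A}$. Suppose that there is a total order $\succeq$ on $\mathcal{A}$ with respect to which $f$ is strictly single-crossing. Fix $r,\sigma,\bar\lambda>0$ and a prior $p_0\in(0,1)$ of the sender. For a prior $p_{D,0}\in(0,1)$ of the decision-maker and a Markov strategy $A:[0,1]\to\Delta(\mathcal{A})$ of the decision-maker, let $$u_{p_{D,0}}(p)=\sum_{a\in\mathcal{A}}f(a,p)\,A\big(a\,\big|\,\phi(p,p_0,p_{D,0})\big),\qquad p\in[0,1],$$ and let $$v_{p_{D,0}}(q)=\sup_{(\lambda_t)_{t\ge 0}}\mathbb{E}\left(r\int_0^\infty e^{-rt}u_{p_{D,0}}(p_t)\,\mathrm{d}t\right)\quad\text{s.t.}\quad \mathrm{d}p_t=\sqrt{\lambda_t}\,\frac{p_t(1-p_t)}{\sigma}\,\mathrm{d}B_t,$$ where $q\in[0,1]$ is the initial condition of $(p_t)_{t\ge0}$ and the supremum is over admissible $[0,\bar\lambda]$-valued controls. Let $p_{D,0},p_{D,0}'\in(0,1)$ satisfy either $p_{D,0}<p_{D,0}'<p_0$ or $p_0<p_{D,0}'<p_{D,0}$, and let $A$ be a myopic Markov strategy that is regular under each of the decision-maker priors $p_{D,0}$ and $p_{D,0}'$. Then $v_{p_{D,0}'}(p_0)\ge v_{p_{D,0}}(p_0)$. (That is, $v(p_0)$ increases as $p_{D,0}<p_0$ increases toward $p_0$, and as $p_{D,0}>p_0$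 decreases toward $p_0$.)
   Context: Setting: a sender (prior $p_0$) and a decision-maker (prior $p_{D,0}$) share the flow payoff $f$; when the sender's belief is $p$, the decision-maker's belief is $$\phi(p,p_0,p_{D,0})=\frac{p}{p+(1-p)\left.\frac{p_0}{1-p_0}\middle/\frac{p_{D,0}}{1-p_{D,0}}\right.}.$$ $f$ is strictly single-crossing (with respect to $\succeq$) iff for all $a'\succ a$ in $\mathcal{A}$ and all $p'>p$ in $[0,1]$, $f(a',p)\ge f(a,p)$ implies $f(a',p')>f(a,p')$. A function $[0,1]\to\mathbb{R}^n$ is piecewise continuous iff its set of discontinuities is a discrete subset of $(0,1)$ (every member is an isolated point of the set). $\Delta(\mathcal{A})$ is the set of probability distributions on $\mathcal{A}$. A Markov strategy of the decision-maker is a piecewise continuous map $A:[0,1]\to\Delta(\mathcal{A})$ (a function of her own belief). It is myopic iff for each $p\in[0,1]$ every action in the support of $A(\cdot|p)$ maximises $f(\cdot,p)$ over $\mathcal{A}$. It is regular under decision-maker prior $p_{D,0}$ iff the sender's induced flow payoff $u_{p_{D,0}}$ is upper semi-continuous. Admissible controls: given an initial condition $q$, a control consists of a $[0,\bar\lambda]$-valued (measurable) process $(\lambda_t)_{t\ge0}$ and a $[0,1]$-valued process $(p_t)_{t\ge0}$ started at $q$ on a probability space carrying a standard Brownian motion $B$, such that $\mathrm{d}p_t=\sqrt{\lambda_t}\,\frac{p_t(1-p_t)}{\sigma}\,\mathrm{d}B_t$ and $(\lambda_t)$ is adapted to the filtration generated by $(p_t)_{t\ge0}$. *)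

(* Defs.v *)
From HB Require Import structures.
From mathcomp Require Export all_boot all_order all_algebra.
From mathcomp Require Export all_classical all_reals all_analysis.
Export Order.TTheory GRing.Theory Num.Theory.
Export numFieldNormedType.Exports.

Set Implicit Arguments.
Unset Strict Implicit.
Unset Printing Implicit Defensive.

Local Open Scope classical_set_scope.
Local Open Scope ring_scope.

(* Functions on [0, 1] are represented by total functions on R of which only
   the restriction to [0, 1] matters; likewise, processes indexed by t >= 0 are
   functions R -> Omega -> R of which only the times t >= 0 matter. *)

Section game.
Context {R : realType} {T : finType}.
Implicit Types (f : T -> R -> R) (A : R -> {ffun T -> R}) (p q : R).

Definition phi (p p0 pD : R) : R :=
  p / (p + (1 - p) * ((p0 / (1 - p0)) / (pD / (1 - pD)))).

Definition strictly_single_crossing (le : rel T) f : Prop :=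
  forall a a', le a a' -> a != a' ->
  forall p p', p \in `[0, 1] -> p' \in `[0, 1] -> p < p' ->
    f a p <= f a' p -> f a p' < f a' p'.

Definition discontinuities n (g : R -> 'rV[R]_n) : set R :=
  [set x : R | x \in `[0, 1] /\
    ~ (g @ within `[0, 1]%classic (nbhs x) --> g x)].

Definition piecewise_continuous n (g : R -> 'rV[R]_n) : Prop :=
  (discontinuities g `<=` `]0, 1[) /\
  discontinuities g `<=` isolated (discontinuities g).

Definition simplex : set {ffun T -> R} :=
  [set m | (forall a, 0 <= m a) /\ \sum_a m a = 1].

(* A p a is the probability A(a | p). *)
Definition markov_strategy A : Prop :=
  (forall p, p \in `[0, 1] -> simplex (A p)) /\
  piecewise_continuous (fun p => \row_(i < #|T|) A p (enum_val i)).

Definition myopic f A : Prop :=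
  forall p, p \in `[0, 1] -> forall a, A p a != 0 -> forall b, f b p <= f a p.

Definition flow_payoff f A (p0 pD p : R) : R :=
  \sum_(a : T) f a p * A (phi p p0 pD) a.

Definition upper_semicontinuous_on (D : set R) (u : R -> R) : Prop :=
  lower_semicontinuous (fun p : subspace D => (- u p)%:E).

Definition regular f A (p0 pD : R) : Prop :=
  upper_semicontinuous_on `[0, 1] (flow_payoff f A p0 pD).

End game.

Section stochastic.
Context {R : realType} d {Omega : measurableType d}.
Context (P : probability Omega R).
Implicit Types (F : R -> set (set Omega)) (X B H : R -> Omega -> R).

Definition sigma_gen (Y : Omega -> R) : set (set Omega) :=
  preimage_set_system setT Y measurable.

Definition filtration F : Prop :=
  [/\ forall t, 0 <= t -> sigma_algebra setT (F t),
      forall t, 0 <= t -> F t `<=` measurable &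
      forall s t, 0 <= s -> s <= t -> F s `<=` F t].

Definition adapted F X : Prop := forall t, 0 <= t -> sigma_gen (X t) `<=` F t.

Definition natural_filtration X (t : R) : set (set Omega) :=
  <<s \bigcup_(s in `[0, t]) sigma_gen (X s) >>.

Definition continuous_paths X : Prop :=
  forall w, {within `[0, +oo[, continuous (X ^~ w)}.

(* The second parameter of normal_prob is the standard deviation. *)
Definition brownian_motion F B : Prop :=
  [/\ filtration F, adapted F B, continuous_paths B, (forall w, B 0 w = 0) &
    forall s t, 0 <= s -> s < t ->
      let D : Omega -> R := fun w => B t w - B s w in
      (forall C, measurable C ->
        P (D @^-1` C) = normal_prob 0 (Num.sqrt (t - s)) C) /\
      (forall G C, F s G -> measurable C ->
        P (G `&` D @^-1` C) = (P G * P (D @^-1` C))%E)].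

(* The process \sum_(i < n) xi_i 1_(]tau_i, tau_(i+1)]]. *)
Record simple_process := SimpleProcess {
  sp_size : nat;
  sp_time : nat -> R;
  sp_coef : nat -> Omega -> R }.

Definition is_simple F (S : simple_process) : Prop :=
  [/\ 0 <= sp_time S 0,
      forall i, sp_time S i <= sp_time S i.+1,
      forall i, sigma_gen (sp_coef S i) `<=` F (sp_time S i) &
      exists K, forall i w, `|sp_coef S i w| <= K].

Definition simple_val (S : simple_process) (t : R) (w : Omega) : R :=
  \sum_(i < sp_size S)
    sp_coef S i w * \1_(`]sp_time S i, sp_time S i.+1]) t.

Definition simple_integral B (S : simple_process) (t : R) (w : Omega) : R :=
  \sum_(i < sp_size S) sp_coef S i w *
    (B (Num.min (sp_time S i.+1) t) w - B (Num.min (sp_time S i) t) w).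

(* I is (a version of) the Ito integral of H against the F-Brownian motion B
   over [0, t], as the L^2 limit of integrals of simple processes that
   approximate H in L^2([0, t] * Omega); by the Ito isometry it is determined
   almost surely by H. *)
Definition is_ito_integral F B H (t : R) (I : Omega -> R) : Prop :=
  exists S : nat -> simple_process,
    [/\ forall n, is_simple F (S n),
        (\int[P]_w \int[lebesgue_measure]_(s in `[0%R, t])
           ((simple_val (S n) s w - H s w) ^+ 2)%:E)%E
          @[n --> \oo] --> 0%E &
        'E_P[(fun w => (simple_integral B (S n) t w - I w) ^+ 2)%R]%E
          @[n --> \oo] --> 0%E].

(* F is the filtration of the probability space relative to which B is a
   Brownian motion and the stochastic integral is taken. The control lam must
   be adapted to the (in general smaller) filtration generated by p. *)
Definition admissible (sigma lambdabar q : R) F B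
    (lam p : R -> Omega -> R) : Prop :=
  [/\ brownian_motion F B,
      [/\ adapted F p, continuous_paths p,
          (forall t w, 0 <= t -> p t w \in `[0, 1]) & (forall w, p 0 w = q)],
      [/\ (forall t w, 0 <= t -> lam t w \in `[0, lambdabar]),
          measurable_fun [set z : R * Omega | 0 <= z.1]
            (fun z : R * Omega => lam z.1 z.2) &
          adapted (natural_filtration p) lam] &
      forall t, 0 <= t ->
        is_ito_integral F B
          (fun s w => Num.sqrt (lam s w) * (p s w * (1 - p s w) / sigma))
          t (fun w => p t w - q)].

Definition discounted_payoff (r : R) (u : R -> R) (p : R -> Omega -> R)
    : \bar R :=
  'E_P[fun w => r * \int[lebesgue_measure]_(t in `[0, +oo[)
                      (expR (- r * t) * u (p t w))].

End stochastic.

(* The probability space and the Brownian motion are part of the control. *)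
Definition value (R : realType) (r sigma lambdabar : R) (u : R -> R) (q : R)
    : \bar R :=
  ereal_sup [set y | exists (d : measure_display) (Omega : measurableType d)
    (P : probability Omega R) (F : R -> set (set Omega))
    (B lam p : R -> Omega -> R),
    admissible P sigma lambdabar q F B lam p /\
    y = discounted_payoff P r u p].

(* Main.v *)
(* The better aligned the decision-maker's prior is with the sender's, the
   closer her belief phi(p) is to the sender's belief p, from the same side.  By
   monotone comparative statics her optimal action at the closer belief lies
   between, in the order of the actions, her optimal action at the farther
   belief and the sender's own optimum, so by single-crossing the sender weakly
   prefers it at p.  Hence the flow payoffs are ordered pointwise on [0, 1];
   since the admissible controls do not depend on the prior of the
   decision-maker, so are the expected discounted payoffs of every control,
   and their suprema. *)

Require Import Defs.
From mathcomp Require Import lra.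

Set Implicit Arguments.
Unset Strict Implicit.
Unset Printing Implicit Defensive.

Local Open Scope classical_set_scope.
Local Open Scope ring_scope.

(* Without measurability of [f] and [g]: the integral is defined for arbitrary
   functions, through suprema over the simple functions below them. *)
Lemma le_integral_nonmeasurable d (T : measurableType d) (R : realType)
    (mu : {measure set T -> \bar R}) (D : set T) (f g : T -> \bar R) :
  (forall x, D x -> (f x <= g x)%E) ->
  (\int[mu]_(x in D) f x <= \int[mu]_(x in D) g x)%E.
Proof.
move=> fg.
have fgD x : ((f \_ D) x <= (g \_ D) x)%E.
  by rewrite !patchE; case: ifPn => // /set_mem /fg.
rewrite /integral; apply: leeB; apply: ereal_sup_le => _ [h hle <-];
  exists h => // x; apply: (le_trans (hle x)).
- by apply: (@funepos_le _ _ setT); rewrite ?inE.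
- by apply: (@funeneg_le _ _ setT); rewrite ?inE.
Qed.

(* [fine] maps infinite integrals to 0, hence the integrable bound. *)
Lemma le_Rintegral_dominated d (T : measurableType d) (R : realType)
    (mu : {measure set T -> \bar R}) (D : set T) (f g h : T -> R) :
  measurable D -> mu.-integrable D (EFin \o h) ->
  (forall x, D x -> `|f x| <= h x) -> (forall x, D x -> `|g x| <= h x) ->
  (forall x, D x -> f x <= g x) ->
  \int[mu]_(x in D) f x <= \int[mu]_(x in D) g x.
Proof.
move=> mD ih fh gh fg.
have fin k : (forall x, D x -> `|k x| <= h x) ->
    (\int[mu]_(x in D) (k x)%:E)%E \is a fin_num.
  move=> kh; rewrite fin_numElt; apply/andP; split.
    have ihN : mu.-integrable D (fun x => - (h x)%:E)%E by exact: integrableN.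
    have := integrable_fin_num mD ihN; rewrite fin_numElt => /andP[+ _].
    move=> /lt_le_trans; apply; apply: le_integral_nonmeasurable => x Dx.
    by rewrite -EFinN lee_fin; have := kh x Dx; rewrite ler_norml => /andP[].
  have := integrable_fin_num mD ih; rewrite fin_numElt => /andP[_].
  apply: le_lt_trans; apply: le_integral_nonmeasurable => x Dx.
  by rewrite lee_fin; have := kh x Dx; rewrite ler_norml => /andP[].
by apply: fine_le; rewrite ?fin//; exact: le_integral_nonmeasurable.
Qed.

(** Up to the factor [r] this is the exponential density, which is integrable. *)
Lemma integrable_expRN (R : realType) (r : R) : 0 < r ->
  lebesgue_measure.-integrable `[0, +oo[ (fun t : R => (expR (- r * t))%:E).
Proof.
move=> r0.
have mI : measurable (`[0, +oo[%classic : set (measurableTypeR R)).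
  exact: measurable_itv.
have i := integrableS (@measurableT _ _) mI (@subsetT _ _)
  (integrable_exponential_pdf r0).
have := integrableZl mI r^-1 i.
apply: eq_integrable => // t; rewrite inE /= in_itv/= andbT => t0.
by rewrite exponential_pdfE// -EFinM mulKf// gt_eqF.
Qed.

(** On every path both discounted integrands are dominated by [M * expR (- r * t)], so the time
    integrals are genuine finite values and compare path by path, whether or not the payoff is
    measurable along the path. *)
Lemma le_discounted_payoff d (Omega : measurableType d) (R : realType)
    (P : probability Omega R) (r M : R) (u v : R -> R) (p : R -> Omega -> R) :
  0 < r -> (forall t w, 0 <= t -> p t w \in `[0, 1]) ->
  {in `[0, 1], forall x, `|u x| <= M} -> {in `[0, 1], forall x, `|v x| <= M} ->
  {in `[0, 1], forall x, u x <= v x} ->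
  (discounted_payoff P r u p <= discounted_payoff P r v p)%E.
Proof.
move=> r0 p01 uM vM uv; rewrite /discounted_payoff unlock.
apply: le_integral_nonmeasurable => w _; rewrite lee_fin ler_pM2l//.
have mI : measurable (`[0, +oo[%classic : set (measurableTypeR R)).
  exact: measurable_itv.
have bnd k : {in `[0, 1], forall x, `|k x| <= M} ->
    forall t, `[0, +oo[%classic t ->
    `|expR (- r * t) * k (p t w)| <= M * expR (- r * t).
  move=> kM t; rewrite /= in_itv/= andbT => t0.
  by rewrite normrM (ger0_norm (expR_ge0 _)) mulrC ler_wpM2r ?expR_ge0 ?kM ?p01.
apply: (@le_Rintegral_dominated _ (measurableTypeR R) _ lebesgue_measure _ _ _
  (fun t => M * expR (- r * t))).
- exact: mI.
- exact: (integrableZl mI M (integrable_expRN r0)).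
- exact: bnd.
- exact: bnd.
- move=> t; rewrite /= in_itv/= andbT => t0.
  by rewrite ler_wpM2l ?expR_ge0 ?uv ?p01.
Qed.

Lemma le_value (R : realType) (r sigma lambdabar M q : R) (u v : R -> R) :
  0 < r ->
  {in `[0, 1], forall x, `|u x| <= M} -> {in `[0, 1], forall x, `|v x| <= M} ->
  {in `[0, 1], forall x, u x <= v x} ->
  (value r sigma lambdabar u q <= value r sigma lambdabar v q)%E.
Proof.
move=> r0 uM vM uv; apply: ge_ereal_sup => y.
move=> [d [W [P [F [B [lam [p [adm ->]]]]]]]].
have [_ [_ _ p01 _] _ _] := adm.
apply: le_trans (le_discounted_payoff P r0 p01 uM vM uv) _.
by apply: ereal_sup_ubound; exists d, W, P, F, B, lam, p.
Qed.

Section beliefs.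
Context {R : realType}.
Implicit Types p pD : R.

Lemma odds_gt0 p : p \in `]0, 1[ -> 0 < p / (1 - p).
Proof. by rewrite in_itv/= => /andP[p0 p1]; rewrite divr_gt0 ?subr_gt0. Qed.

Lemma ltr_odds p p' : p \in `]0, 1[ -> p' \in `]0, 1[ ->
  p < p' -> p / (1 - p) < p' / (1 - p').
Proof.
rewrite !in_itv/= => /andP[p0 p1] /andP[p'0 p'1] pp'.
rewrite ltr_pdivrMr ?subr_gt0// mulrAC ltr_pdivlMr ?subr_gt0//; nra.
Qed.

Lemma phi_itv p p0 pD : p0 \in `]0, 1[ -> pD \in `]0, 1[ -> p \in `[0, 1] ->
  phi p p0 pD \in `[0, 1].
Proof.
move=> /odds_gt0 o0 /odds_gt0 oD; rewrite !in_itv/= => /andP[p_ge0 p_le1].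
rewrite /phi; set k := _ / (pD / _).
have k0 : 0 < k by exact: divr_gt0.
have den : 0 < p + (1 - p) * k by nra.
by rewrite divr_ge0 ?(ltW den)//= ler_pdivrMr// mul1r; nra.
Qed.

Lemma phi0 p0 pD : phi 0 p0 pD = 0.
Proof. by rewrite /phi mul0r. Qed.

Lemma phi1 p0 pD : phi 1 p0 pD = 1.
Proof. by rewrite /phi subrr mul0r addr0 divr1. Qed.

(** Equal priors make the odds ratio 1. The sender's own belief is thus a value of [phi], so
    [phi_lt] can also place it relative to the decision-maker's beliefs. *)
Lemma phi_id p p0 : p0 \in `]0, 1[ -> phi p p0 p0 = p.
Proof.
move=> /odds_gt0 o0; rewrite /phi divff ?gt_eqF//.
by rewrite mulr1 addrC subrK divr1.
Qed.

(** Larger prior odds of the decision-maker lower the weight on [1 - p] in the denominator. *)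
Lemma phi_lt p p0 pD pD' : p0 \in `]0, 1[ -> pD \in `]0, 1[ ->
  pD' \in `]0, 1[ -> p \in `]0, 1[ -> pD < pD' -> phi p p0 pD < phi p p0 pD'.
Proof.
move=> /odds_gt0 o0 iD iD' ip ltD.
have oD := odds_gt0 iD; have oD' := odds_gt0 iD'.
have := ltr_odds iD iD' ltD.
rewrite in_itv/= in ip; case/andP: ip => p_gt0 p_lt1.
rewrite /phi; move: (p0 / _) (pD / _) (pD' / _) o0 oD oD' => a b c a0 b0 c0 bc.
have ab0 : 0 < a / b by exact: divr_gt0.
have ac0 : 0 < a / c by exact: divr_gt0.
have lt_ac : a / c < a / b by rewrite ltr_pM2l// ltf_pV2.
rewrite ltr_pM2l// ltf_pV2 ?posrE; nra.
Qed.

End beliefs.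

Section game.
Context {R : realType} {T : finType}.
Implicit Types (f : T -> R -> R) (A : R -> {ffun T -> R}).

(** Here [x] is the farther belief and [x'] the nearer one. If [a'] differs from [a] in the
    direction of the move from [x] to [x'], single-crossing between [x'] and [p] transfers the
    optimality of [a'] at [x'] to [p], by contradiction when [p] lies below. The opposite direction
    is incompatible with optimality at both [x] and [x']. *)
Lemma optimal_action_le (le : rel T) f (x x' p : R) (a a' : T) :
  total le -> strictly_single_crossing le f ->
  x \in `[0, 1] -> x' \in `[0, 1] -> p \in `[0, 1] ->
  x < x' /\ x' < p \/ p < x' /\ x' < x ->
  (forall b, f b x <= f a x) -> (forall b, f b x' <= f a' x') ->
  f a p <= f a' p.
Proof.
move=> tot ssc ix ix' ip h opta opta'.
have [->//|ne] := eqVneq a a'; have ne' : a' != a by rewrite eq_sym.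
case: h => -[h1 h2].
- have /orP[l|l] := tot a a'.
    exact/ltW/(ssc _ _ l ne _ _ ix' ip h2).
  have := ssc _ _ l ne' _ _ ix ix' h1 (opta a').
  by rewrite ltNge opta'.
- have /orP[l|l] := tot a a'.
    have := ssc _ _ l ne _ _ ix' ix h2 (opta' a).
    by rewrite ltNge opta.
  rewrite leNgt; apply/negP => lt_p.
  have := ssc _ _ l ne' _ _ ip ix' h1 (ltW lt_p).
  by rewrite ltNge opta'.
Qed.

(** This handles mixing over ties: both means become double sums with product weights [m a * m' a'],
    which compare term by term and vanish off the supports. *)
Lemma le_mean (g : T -> R) (m m' : {ffun T -> R}) :
  simplex m -> simplex m' ->
  (forall a a', m a != 0 -> m' a' != 0 -> g a <= g a') ->
  \sum_a g a * m a <= \sum_a g a * m' a.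
Proof.
move=> [m0 m1] [m'0 m'1] gle.
have -> : \sum_a g a * m a = \sum_a \sum_a' g a * m a * m' a'.
  by apply: eq_bigr => a _; rewrite -mulr_sumr m'1 mulr1.
have -> : \sum_a g a * m' a = \sum_a \sum_a' g a' * m a * m' a'.
  rewrite exchange_big; apply: eq_bigr => a' _ /=.
  by rewrite -mulr_suml -mulr_sumr m1 mulr1.
apply: ler_sum => a _; apply: ler_sum => a' _.
have [->|na] := eqVneq (m a) 0; first by rewrite !(mulr0, mul0r).
have [->|na'] := eqVneq (m' a') 0; first by rewrite !mulr0.
by rewrite !ler_wpM2r// gle.
Qed.

Lemma flow_payoff_le (le : rel T) f A (p0 pD pD' : R) :
  total le -> strictly_single_crossing le f ->
  p0 \in `]0, 1[ -> pD \in `]0, 1[ -> pD' \in `]0, 1[ ->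
  pD < pD' /\ pD' < p0 \/ p0 < pD' /\ pD' < pD ->
  (forall p, p \in `[0, 1] -> simplex (A p)) -> myopic f A ->
  {in `[0, 1], forall p, flow_payoff f A p0 pD p <= flow_payoff f A p0 pD' p}.
Proof.
move=> tot ssc ip0 iD iD' hord sA myo p ip.
(* Certainty is fixed by [phi] whatever the prior, so the payoffs agree at the endpoints, where the
   strict [phi_lt] fails. *)
have [->|n0] := eqVneq p 0; first by rewrite /flow_payoff !phi0.
have [->|n1] := eqVneq p 1; first by rewrite /flow_payoff !phi1.
have ip' : p \in `]0, 1[.
  by move: ip; rewrite !in_itv/= !le_eqVlt eq_sym (negbTE n0) (negbTE n1).
have ix := phi_itv ip0 iD ip; have ix' := phi_itv ip0 iD' ip.
apply: le_mean; [exact: sA|exact: sA|move=> a a' na na'].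
apply: (optimal_action_le tot ssc ix ix' ip _ (myo _ ix _ na) (myo _ ix' _ na')).
(* The selected occurrences are those of [p] as the sender's belief; all inequalities become
   instances of [phi_lt]. *)
rewrite -{4 5}(phi_id p ip0).
by case: hord => -[h1 h2]; [left|right]; split; apply: phi_lt.
Qed.

(** The bound sums the maxima of the continuous [f a] in absolute value. It is uniform in [pD], so
    that one [M] serves both priors. *)
Lemma flow_payoff_bounded f A (p0 : R) :
  (forall a, {within `[0, 1], continuous (f a)}) ->
  p0 \in `]0, 1[ -> (forall p, p \in `[0, 1] -> simplex (A p)) ->
  exists M, forall pD, pD \in `]0, 1[ ->
    {in `[0, 1], forall p, `|flow_payoff f A p0 pD p| <= M}.
Proof.
move=> cf ip0 sA.
have bnd a : {M | forall p, p \in `[0, 1] -> `|f a p| <= M}.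
  apply: cid.
  have [c _ maxc] := EVT_max ler01 (cf a).
  have [c' _ minc'] := EVT_min ler01 (cf a).
  exists (Num.max (f a c) (- f a c')) => p ip.
  by rewrite ler_norml lerNl !le_max maxc// lerN2 minc' ?orbT.
exists (\sum_a sval (bnd a)) => pD iD p ip.
have [m0 m1] := sA _ (phi_itv ip0 iD ip).
apply: le_trans (ler_norm_sum _ _ _) _; apply: ler_sum => a _.
rewrite normrM (ger0_norm (m0 a)).
apply: le_trans (svalP (bnd a) p ip); rewrite ler_piMr//.
by rewrite -m1 (bigD1 a)//= lerDl sumr_ge0.
Qed.

End game.

Theorem proposition6 (R : realType) (T : finType) (f : T -> R -> R)
    (hfc : forall a, {within `[0, 1], continuous (f a)})
    (hsc : exists le : rel T,
      [/\ reflexive le, antisymmetric le, transitive le, total le &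
          strictly_single_crossing le f])
    (r sigma lambdabar : R)
    (hr : 0 < r) (hsigma : 0 < sigma) (hlambdabar : 0 < lambdabar)
    (p0 : R) (hp0 : p0 \in `]0, 1[)
    (pD pD' : R) (hpD : pD \in `]0, 1[) (hpD' : pD' \in `]0, 1[)
    (hord : (pD < pD' /\ pD' < p0) \/ (p0 < pD' /\ pD' < pD))
    (A : R -> {ffun T -> R})
    (hA : markov_strategy A) (hmyopic : myopic f A)
    (hreg : regular f A p0 pD) (hreg' : regular f A p0 pD') :
  (value r sigma lambdabar (flow_payoff f A p0 pD) p0
     <= value r sigma lambdabar (flow_payoff f A p0 pD') p0)%E.
Proof.
have [le [_ _ _ tot ssc]] := hsc; have [sA _] := hA.
have [M bM] := flow_payoff_bounded hfc hp0 sA.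
apply: (@le_value _ _ _ _ M) => //; [exact: bM|exact: bM|].
exact: flow_payoff_le tot ssc hp0 hpD hpD' hord sA hmyopic.
Qed.
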